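(* For every instance $G$ of OSOW with post-allocation stochasticity (as defined in the context), the value of non-adaptive Greedy satisfies $\sum_{i\in I}F_i(\mathrm{ALG})\ge \tfrac12\,\mathrm{OPT}^c(G)$; i.e., non-adaptive Greedy is $0.5$-competitive against $\mathrm{OPT}^c$.
   Context: Instance $G$: resources $I$, arrivals $T=\{1,\dots,T\}$ arriving online in order; for each $t$ a set $N_t$ of configurations $(R,t)$ with $R\subseteq I$; $N=\bigcup_t N_t$, $N_i=\{(R,t)\in N:i\in R\}$; at most one configuration can be chosen per arrival. Each $i\in I$ has a monotone $f_i:2^N\to\mathbb{R}_{\ge0}$ with $f_i(\emptyset)=0$, $f_i(S)=f_i(S\cap N_i)$, linear over each $N_t$ ($f_i(N_t\cup S)=f_i(S)+\sum_{e\in N_t}f_i(e\mid S)$ for $S\subseteq N\setminus N_t$, where $f(X\mid S)=f(X\cup S)-f(S)$), and such that every total order on $N$ in which $N_{t+1}$ comes entirely after $N_t$ for all $t$ is a submodular order for $f_i$ (a total order $\pi$ is a submodular order for $f$ if $f(C\mid A)\le f(C\mid B)$ whenever $B\subseteq A$, every element of $A\setminus B$ comes after every element of $B$, and every element of $C$ comes after every element of $A$). For each configuration $e=(R,t)$ and $i\in R$ there is a probability $p_{i,e}$ that $i$ is active in $e$; events for different arrivals are independent. For $X\subseteq S\subseteq N_i$, $\gamma(X,S)=\prod_{e\in X}p_{i,e}\prod_{e\in S\setminus X}(1-p_{i,e})$, and $F_i(S)=\sum_{X\subseteq N_i}\gamma(X,N_i)\,f_i(X\cap S)$ for $S\subseteq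 N$. Non-adaptive Greedy, with $\mathrm{ALG}(t)$ the set of configurations chosen before $t$, chooses at arrival $t$ a configuration in $\arg\max_{e\in N_t}\sum_{i\in I}F_i(e\mid \mathrm{ALG}(t))$ (it does not observe activity outcomes); $\mathrm{ALG}$ is its final set. Let $\Delta(N)=\{(y_e)_{e\in N}: y_e\ge0,\ \sum_{e\in N_t}y_e\le 1\ \forall t\}$; for $Y\in\Delta(N)$, $F^c_i(Y)=\max\{\sum_{X\subseteq N}\alpha(X)f_i(X): \alpha\ge0,\ \sum_X\alpha(X)=1,\ \sum_{X\ni e}\alpha(X)\le p_{i,e}\,y_e\ \forall e\in N\}$; $\mathrm{OPT}^c(G)=\max_{Y\in\Delta(N)}\sum_{i\in I}F^c_i(Y)$. *)

(* Defs.v *)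
From HB Require Import structures.
From mathcomp Require Import all_boot all_order all_algebra.
From mathcomp Require Import all_classical all_reals all_analysis.

Set Implicit Arguments.
Unset Strict Implicit.
Unset Printing Implicit Defensive.

Import Order.TTheory GRing.Theory Num.Theory.
Import numFieldNormedType.Exports.

Local Open Scope set_scope.
Local Open Scope ring_scope.

(* [set ..] denotes a finite set, except under %classic. *)

Section SetFunctions.
Variables (R : realType) (E : finType).
Implicit Types (N A B C X Y S : {set E}) (f : {set E} -> R) (pi : rel E).

(* f(X | S) *)
Definition marginal f X S : R := f (X :|: S) - f S.

Definition total_order_on N pi : Prop :=
  [/\ {in N, reflexive pi}, {in N &, antisymmetric pi},
      {in N & &, transitive pi} & {in N &, total pi}].

(* Every element of Y comes (strictly) after every element of X. *)
Definition entirely_after pi X Y : Prop :=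
  forall x y, x \in X -> y \in Y -> (x != y) && pi x y.

Definition submodular_order N pi f : Prop :=
  forall A B C, A \subset N -> B \subset A -> C \subset N ->
    entirely_after pi B (A :\: B) -> entirely_after pi A C ->
    marginal f C A <= marginal f C B.

End SetFunctions.

(* The configuration (R, t); the n arrivals are numbered 0, .., n - 1. *)
Notation config I n := ({set I} * 'I_n)%type.

Definition arrival_block (I : finType) (n : nat) (N : {set config I n})
  (t : 'I_n) : {set config I n} := [set e in N | e.2 == t].

Definition resource_block (I : finType) (n : nat) (N : {set config I n})
  (i : I) : {set config I n} := [set e in N | i \in e.1].

(* Values of f i outside the subsets of N, and of p i outside N, are
   irrelevant.  The values of p i e for i \notin e.1 are arbitrary
   probabilities: they occur only in the constraints defining Fc, whose value
   they do not affect because f i ignores such e.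
   In instance_order the blocks are compared for all s < t, not only for
   consecutive arrivals, so that an arrival without configurations does not
   break the chain. *)
Record instance (R : realType) (I : finType) (n : nat) := Instance {
  configs : {set config I n};
  f : I -> {set config I n} -> R;
  p : I -> config I n -> R;
  instance_nonneg : forall i (X : {set config I n}),
    X \subset configs -> 0 <= f i X;
  instance_mono : forall i (X Y : {set config I n}),
    X \subset Y -> Y \subset configs -> f i X <= f i Y;
  instance_set0 : forall i, f i finset.set0 = 0;
  instance_local : forall i (S : {set config I n}), S \subset configs ->
    f i S = f i (S :&: resource_block configs i);
  instance_linear : forall i t (S : {set config I n}),
    S \subset configs :\: arrival_block configs t ->
    f i (arrival_block configs t :|: S) =
      f i S + \sum_(e in arrival_block configs t) marginal (f i) [set e] S;
  instance_order : forall i (pi : rel (config I n)),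
    total_order_on configs pi ->
    (forall s t : 'I_n, (s < t)%N ->
       entirely_after pi (arrival_block configs s) (arrival_block configs t)) ->
    submodular_order configs pi (f i);
  instance_prob : forall i e, e \in configs -> 0 <= p i e <= 1
}.

Section Values.
Variables (R : realType) (I : finType) (n : nat) (G : instance R I n).
Local Notation N := (configs G).
Local Notation "'N_[ t ]" := (arrival_block N t) (at level 0).

(* For X \subset S: the probability that X is the set of those elements of S
   in which i is active, activity being independent across configurations. *)
Definition gamma (i : I) (X S : {set config I n}) : R :=
  (\prod_(e in X) p G i e) * (\prod_(e in S :\: X) (1 - p G i e)).

Definition F (i : I) (S : {set config I n}) : R :=
  \sum_(X : {set config I n} | X \subset resource_block N i)
    gamma i X (resource_block N i) * f G i (X :&: S).

(* alg t is the configuration chosen at arrival t, if any. *)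
Definition chosen_before (alg : 'I_n -> option (config I n)) (t : nat)
  : {set config I n} :=
  [set e | [exists s : 'I_n, (s < t)%N && (alg s == Some e)]].

Definition chosen (alg : 'I_n -> option (config I n)) : {set config I n} :=
  chosen_before alg n.

Definition greedy_score (S : {set config I n}) (e : config I n) : R :=
  \sum_(i : I) marginal (F i) [set e] S.

(* alg is a possible run, under some resolution of the ties in the argmax.
   Nothing is chosen exactly at the arrivals without configurations. *)
Definition nonadaptive_greedy (alg : 'I_n -> option (config I n)) : Prop :=
  forall t : 'I_n,
    if alg t is Some e then
      e \in 'N_[t] /\
      forall e', e' \in 'N_[t] ->
        greedy_score (chosen_before alg t) e' <=
        greedy_score (chosen_before alg t) e
    else 'N_[t] = finset.set0.

Definition Delta (y : config I n -> R) : Prop :=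
  (forall e, e \in N -> 0 <= y e) /\
  (forall t : 'I_n, \sum_(e in 'N_[t]) y e <= 1).

(* alpha is a feasible distribution over the subsets of N in F^c_i(y). *)
Definition Fc_feasible (i : I) (y : config I n -> R)
  (alpha : {set config I n} -> R) : Prop :=
  [/\ forall X : {set config I n}, X \subset N -> 0 <= alpha X,
      \sum_(X : {set config I n} | X \subset N) alpha X = 1 &
      forall e, e \in N ->
        \sum_(X : {set config I n} | (X \subset N) && (e \in X)) alpha X
          <= p G i e * y e].

Definition Fc_value (i : I) (alpha : {set config I n} -> R) : R :=
  \sum_(X : {set config I n} | X \subset N) alpha X * f G i X.

Definition Fc_values (i : I) (y : config I n -> R) : set R :=
  [set Fc_value i alpha | alpha in [set alpha | Fc_feasible i y alpha]]%classic.

(* sup is a maximum here: see Fc_max and OPTc_max. *)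
Definition Fc (i : I) (y : config I n -> R) : R := sup (Fc_values i y).

Definition OPTc_values : set R :=
  [set \sum_(i : I) Fc i y | y in [set y | Delta y]]%classic.

Definition OPTc : R := sup OPTc_values.

End Values.

Definition is_max (R : realType) (A : set R) (m : R) : Prop :=
  A m /\ (ubound A m)%classic.

Section Attainment.
Variable R : realType.

Let is_max_sup (A : set R) m : is_max A m -> is_max A (sup A).
Proof.
move=> [Am ubm]; suff -> : sup A = m by [].
apply/eqP; rewrite eq_le; apply/andP; split.
  by apply: ge_sup => //; exists m.
by apply: ub_le_sup => //; exists m.
Qed.

Section Closed.
Variable T : topologicalType.

#[local] Lemma closed_forall J (A : J -> set T) :
  (forall j, closed (A j)) -> closed [set x | forall j, A j x]%classic.
Proof.
move=> cA; suff -> : [set x | forall j, A j x]%classic =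
   (\bigcap_(j in setT) A j)%classic by exact: closed_bigI.
by apply/seteqP; split=> x /= h j //=; apply: h.
Qed.

#[local] Lemma closed_imply (P : Prop) (A : set T) :
  closed A -> closed [set x | P -> A x]%classic.
Proof. by move=> cA; apply: closed_forall. Qed.

#[local] Lemma closed_le_fun (g h : T -> R) :
  continuous g -> continuous h -> closed [set x | g x <= h x]%classic.
Proof.
move=> cg ch.
have -> : [set x | g x <= h x]%classic =
    ((fun x => g x - h x) @^-1` [set r | r <= 0])%classic.
  by apply/seteqP; split=> x /=; rewrite subr_le0.
apply: preimage_closed (@closed_le R 0).
by move=> x _; exact: (cvgB (cg x) (ch x)).
Qed.

#[local] Lemma closed_unit_interval (g : T -> R) :
  continuous g -> closed [set x | 0 <= g x <= 1]%classic.
Proof.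
move=> cg.
have -> : [set x | 0 <= g x <= 1]%classic =
    ([set x | (0 : R) <= g x] `&` [set x | g x <= 1])%classic.
  by apply/seteqP; split=> x /= /andP.
by apply: closedI; apply: closed_le_fun => //; exact: cst_continuous.
Qed.

#[local] Lemma continuous_scale (g : T -> R) r :
  continuous g -> continuous (fun x => g x * r).
Proof. by move=> cg x; exact: (cvgM (cg x) (cvg_cst r)). Qed.

#[local] Lemma continuous_sum (K : Type) (r : seq K) (P : pred K) (g : K -> T -> R) :
  (forall k, continuous (g k)) ->
  continuous (fun x => \sum_(k <- r | P k) g k x).
Proof.
move=> cg; apply: continuous_big => [|k _]; last exact: cg.
exact: add_continuous.
Qed.

End Closed.

Let cube_max (K : finType) (D : set (prod_topology (fun _ : K => R)))
    (c : prod_topology (fun _ : K => R) -> R) :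
  closed D -> (forall x, D x -> forall k, 0 <= x k <= 1) ->
  (D !=set0)%classic -> continuous c ->
  exists2 x, D x & forall y, D y -> c y <= c x.
Proof.
move=> cD Dcube D0 cc.
have cptD : compact D.
  apply: (subclosed_compact cD (@tychonoff K (fun=> R)
    (fun=> `[0, 1]%classic) _)) => [k|x Dx k].
    exact: segment_compact.
  by rewrite /= in_itv /= Dcube.
have [|x] := @compact_EVT_max _ R c D D0 cptD.
  exact: continuous_subspaceT.
rewrite inE => Dx xmax; exists x => // y Dy.
by apply: xmax; rewrite inE.
Qed.

Let coordinate_continuous (K : eqType) (k : K) :
  continuous (fun x : prod_topology (fun _ : K => R) => x k).
Proof. exact: (@proj_continuous K (fun=> R) k). Qed.

Variables (I : finType) (n : nat) (G : instance R I n).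
Local Notation N := (configs G).

Let closed_feasible (T : topologicalType) (i : I) (y : config I n -> T -> R)
    (alpha : {set config I n} -> T -> R) :
  (forall e, continuous (y e)) -> (forall X, continuous (alpha X)) ->
  closed [set x | Fc_feasible G i (y^~ x) (alpha^~ x)]%classic.
Proof.
move=> cy ca.
have -> : [set x | Fc_feasible G i (y^~ x) (alpha^~ x)]%classic =
  ([set x | forall X : {set config I n}, X \subset N -> 0 <= alpha X x] `&`
   ([set x | \sum_(X : {set config I n} | X \subset N) alpha X x <= 1] `&`
    [set x | 1 <= \sum_(X : {set config I n} | X \subset N) alpha X x]) `&`
   [set x | forall e, e \in N ->
     \sum_(X : {set config I n} | (X \subset N) && (e \in X)) alpha X x
       <= p G i e * y e x])%classic.
  apply/seteqP; split=> x /=.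
    by move=> [h1 h2 h3]; split=> //; split=> //; rewrite h2.
  move=> [[h1 [h2 h2']] h3]; split=> //.
  by apply/eqP; rewrite eq_le h2 h2'.
apply: closedI; first apply: closedI; last 2 first.
- apply: closedI; apply: closed_le_fun; try exact: cst_continuous.
    exact: continuous_sum.
  exact: continuous_sum.
- apply: closed_forall => e; apply: closed_imply.
  apply: closed_le_fun; first exact: continuous_sum.
  by move=> x; apply: cvgM; [exact: cvg_cst | exact: cy].
- apply: closed_forall => X; apply: closed_imply.
  by apply: closed_le_fun; [exact: cst_continuous | exact: ca].
Qed.

Let closed_Delta (T : topologicalType) (y : config I n -> T -> R) :
  (forall e, continuous (y e)) -> closed [set x | Delta G (y^~ x)]%classic.
Proof.
move=> cy; apply: closedI; apply: closed_forall => k.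
  by apply: closed_imply; apply: closed_le_fun => //; exact: cst_continuous.
by apply: closed_le_fun; [exact: continuous_sum | exact: cst_continuous].
Qed.

Let alpha_restrict (alpha : {set config I n} -> R) (X : {set config I n}) :=
  if X \subset N then alpha X else 0.

Let alpha_restrict_feasible i y alpha : Fc_feasible G i y alpha ->
  Fc_feasible G i y (alpha_restrict alpha).
Proof.
move=> [h1 h2 h3]; split=> [X XN|| e eN].
- by rewrite /alpha_restrict XN h1.
- by rewrite -[RHS]h2; apply: eq_bigr => X XN; rewrite /alpha_restrict XN.
- apply: le_trans (h3 e eN); rewrite le_eqVlt; apply/orP; left; apply/eqP.
  by apply: eq_bigr => X /andP[XN _]; rewrite /alpha_restrict XN.
Qed.

Let alpha_restrict_value i alpha :
  Fc_value G i (alpha_restrict alpha) = Fc_value G i alpha.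
Proof. by apply: eq_bigr => X XN; rewrite /alpha_restrict XN. Qed.

Let alpha_restrict_cube i y alpha X : Fc_feasible G i y alpha ->
  0 <= alpha_restrict alpha X <= 1.
Proof.
move=> [h1 h2 h3]; rewrite /alpha_restrict.
case: ifPn => XN; last by rewrite lexx ler01.
rewrite h1 //= -h2 (bigD1 X) //= lerDl.
by apply: sumr_ge0 => Y /andP[YN _]; exact: h1.
Qed.

Let point_feasible i y : Delta G y ->
  Fc_feasible G i y (fun X => (X == finset.set0)%:R).
Proof.
move=> [y0 _]; split=> [X _||e eN]; first exact: ler0n.
- rewrite (bigD1 finset.set0) ?finset.sub0set // eqxx big1 /= ?addr0 // => X.
  by case/andP=> _ /negbTE->.
- rewrite big1 => [|X /andP[_ eX]].
    by apply: mulr_ge0; [have /andP[] := instance_prob i eN | exact: y0].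
  by case: eqP eX => // ->; rewrite inE.
Qed.

Lemma Fc_max i y : Delta G y -> is_max (Fc_values G i y) (Fc G i y).
Proof.
move=> Dy; pose T := prod_topology (fun _ : {set config I n} => R).
pose D := ([set x : T | forall X, 0 <= x X <= 1] `&`
           [set x : T | Fc_feasible G i y x])%classic.
have DP alpha : Fc_feasible G i y alpha -> D (alpha_restrict alpha).
  move=> h; split=> [X|] /=; first exact: alpha_restrict_cube h.
  exact: alpha_restrict_feasible.
have cT (X : {set config I n}) : continuous (fun x : T => x X).
  exact: coordinate_continuous.
have [] := @cube_max _ D (Fc_value G i).
- apply: closedI.
    by apply: closed_forall => X; exact: closed_unit_interval (cT X).
  apply: (@closed_feasible T i (fun e _ => y e) (fun X x => x X)) => // e.
  exact: cst_continuous.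
- by move=> x [].
- by exists (alpha_restrict (fun X => (X == finset.set0)%:R)); apply: DP;
    exact: point_feasible.
- apply: continuous_sum => X.
  exact: continuous_scale (cT X).
move=> x [_ fx] xmax; apply: (@is_max_sup _ (Fc_value G i x)); split.
  by exists x.
move=> _ [alpha falpha <-]; rewrite -(alpha_restrict_value i alpha).
exact: xmax (DP _ falpha).
Qed.

Lemma OPTc_max : is_max (OPTc_values G) (OPTc G).
Proof.
pose K := (config I n + I * {set config I n})%type.
pose T := prod_topology (fun _ : K => R).
pose yof (e : config I n) (x : T) := x (inl e).
pose aof i (X : {set config I n}) (x : T) := x (inr (i, X)).
pose D := ([set x : T | forall k, 0 <= x k <= 1] `&`
  ([set x : T | Delta G (yof^~ x)] `&`
   [set x : T | forall i, Fc_feasible G i (yof^~ x) (aof i ^~ x)]))%classic.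
pose val (x : T) := \sum_(i : I) Fc_value G i (aof i ^~ x).
have cK (k : K) : continuous (fun x : T => x k).
  exact: coordinate_continuous.
pose mk (y : config I n -> R) (a : I -> {set config I n} -> R) : T :=
  fun k => match k with
           | inl e => if e \in N then y e else 0
           | inr (i, X) => alpha_restrict (a i) X
           end.
have DP y a : Delta G y -> (forall i, Fc_feasible G i y (a i)) -> D (mk y a).
  move=> [y0 y1] fa; split; last split.
  - case=> [e|[i X]] /=; last exact: alpha_restrict_cube (fa i).
    case: ifPn => eN; last by rewrite lexx ler01.
    rewrite y0 //= (le_trans _ (y1 e.2)) // (bigD1 e) ?inE ?eN ?eqxx //= lerDl.
    by apply: sumr_ge0 => e' /andP[]; rewrite inE => /andP[e'N _] _; exact: y0.
  - split=> [e eN|t] /=; first by rewrite /yof /= eN y0.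
    rewrite (le_trans _ (y1 t)) // le_eqVlt; apply/orP; left; apply/eqP.
    by apply: eq_bigr => e; rewrite inE /yof /= => /andP[-> _].
  - move=> i; have [h1 h2 h3] := alpha_restrict_feasible (fa i).
    by split=> // e eN; rewrite /yof /= eN; exact: h3.
have vP y a : val (mk y a) = \sum_(i : I) Fc_value G i (a i).
  by apply: eq_bigr => i _; rewrite -[RHS]alpha_restrict_value.
have [] := @cube_max K D val.
- apply: closedI; last apply: closedI.
  + by apply: closed_forall => k; exact: closed_unit_interval (cK k).
  + by apply: closed_Delta => e; exact: cK.
  + by apply: closed_forall => i; apply: closed_feasible => ?; exact: cK.
- by move=> x [].
- have D0 : Delta G (fun=> 0) by split=> // t; rewrite big1.
  by exists (mk (fun=> 0) (fun _ X => (X == finset.set0)%:R)); apply: DP => // i;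
    exact: point_feasible.
- apply: continuous_sum => i; apply: continuous_sum => X.
  exact: continuous_scale (cK (inr (i, X))).
move=> x [_ [Dx fx]] xmax.
have vmax y : Delta G y -> \sum_(i : I) Fc G i y <= val x.
  move=> Dy; have /choice[a aP] i : exists a, Fc_feasible G i y a /\
      Fc_value G i a = Fc G i y.
    by have [[a fa va] _] := Fc_max i Dy; exists a.
  rewrite (eq_bigr (fun i => Fc_value G i (a i))) => [|i _].
    by rewrite -(vP y a); apply/xmax/DP => // i; case: (aP i).
  by case: (aP i).
apply: (@is_max_sup _ (\sum_(i : I) Fc G i (yof^~ x))); split.
  by exists (yof^~ x).
move=> _ [y Dy <-]; apply: le_trans (vmax y Dy) _.
apply: ler_sum => i _; have [_] := Fc_max i Dx; apply.
by exists (aof i ^~ x); first exact: fx.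
Qed.

End Attainment.

(* Main.v *)
Require Import Defs.
From HB Require Import structures.
From mathcomp Require Import all_boot all_order all_algebra.
From mathcomp Require Import all_classical all_reals all_analysis.
From mathcomp Require Import zify lra.

(* Let A be the greedy choice, Z the random activity of resource i, and A_t the
   part of A before arrival t.  Removing the configurations of a set X one by
   one, earliest arrival first, the submodular orders give
     f_i(X) <= f_i(X u (Z n A))
            <= f_i(Z n A) + sum over e = (R, t) in X of f_i(e | Z n A_t).
   Average over Z and over X drawn from an optimal alpha independently of Z:
   as Pr[e in X] <= p_{i,e} y_e and the activity of e is independent of that of
   A_t, this yields F^c_i(y) <= F_i(A) + sum_e y_e F_i(e | A_t).  Summed over i,
   the last term is a fractional choice at each arrival, hence at most the gain
   of the greedy choice, and these gains add up to sum_i F_i(A). *)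

Local Open Scope ring_scope.

Set Implicit Arguments.
Unset Strict Implicit.
Unset Printing Implicit Defensive.

Import Order.TTheory GRing.Theory Num.Theory.

(** Pairs each subset avoiding [e] with the one obtained by adding [e]; this is how one conditions
    on the activity of [e] below. *)
Lemma sum_subsets_setD1 (R : nmodType) (T : finType) (D : {set T}) (e : T) (h : {set T} -> R) :
  e \in D ->
  \sum_(X : {set T} | X \subset D) h X =
  \sum_(X : {set T} | X \subset D :\ e) (h X + h (e |: X)).
Proof.
move=> eD; rewrite big_split /= (bigID (fun X : {set T} => e \notin X)) /=.
congr (_ + _); first by apply: eq_bigl => X; rewrite finset.subsetD1.
rewrite (reindex_onto (fun X => e |: X) (fun X => X :\ e)) /=; last first.
  by move=> X /andP[_]; rewrite negbK => /finset.setD1K.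
apply: eq_bigl => X; rewrite finset.subsetD1 finset.subUset finset.sub1set eD.
rewrite setU11 /= andbT; congr (_ && _).
apply/eqP/idP => [<-|eX]; first by rewrite setD11.
by rewrite setU1K.
Qed.

Section Greedy.
Variables (R : realType) (I : finType) (n : nat) (G : instance R I n).
Implicit Types (A B C D S X Z : {set config I n}) (e : config I n) (i : I).
Local Notation N := (configs G).
Local Notation f := (f G).
Local Notation p := (p G).

(** Stated by arrival rather than by the history of a run, so that it also applies to the active
    part of the chosen set. *)
Definition before S (t : nat) : {set config I n} := [set e in S | (e.2 < t)%N].

(** * Consequences of the submodular orders *)

Lemma marginal_ge0 i S X : S \subset N -> X \subset N ->
  0 <= marginal (f i) X S.
Proof.
by move=> SN XN; rewrite subr_ge0 instance_mono ?finset.subsetUr ?finset.subUset ?SN ?XN.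
Qed.

(** Arrivals are compared only weakly here. Ties within an arrival are broken by placing [B] first,
    then [A :\: B], then the rest; arrivals stay in sequence, so this is a submodular order. *)
Lemma marginal_diminishing i A B C :
  A \subset N -> B \subset A -> C \subset N -> [disjoint A & C] ->
  (forall x y, x \in B -> y \in A :\: B -> (x.2 <= y.2)%N) ->
  (forall x y, x \in A -> y \in C -> (x.2 <= y.2)%N) ->
  marginal (f i) C A <= marginal (f i) C B.
Proof.
move=> AN BA CN dAC hBA hAC.
pose g x : nat := if x \in B then 0%N else if x \in A then 1%N else 2%N.
pose m := #|{: config I n}|.
(* Lexicographic in arrival, [g] and rank: [g x <= 2] and [enum_rank x < m] justify the bases 3 and
   [m]. The rank makes [key] injective, hence the order antisymmetric. *)
pose key (x : config I n) : nat := ((x.2 * 3 + g x) * m + enum_rank x)%N.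
have g2 x : (g x <= 2)%N by rewrite /g; case: ifP => // _; case: ifP.
have key_inj : injective key.
  move=> x y /(congr1 (modn^~ m)).
  rewrite /key !modnMDl !modn_small ?ltn_ord // => kxy.
  exact/enum_rank_inj/ord_inj.
have key_lt (x y : config I n) : (x.2 * 3 + g x < y.2 * 3 + g y)%N -> (x != y) && (key x <= key y)%N.
  move=> lt; apply/andP; split; first by apply: contraTneq lt => ->; rewrite ltnn.
  have := ltn_ord (enum_rank x); rewrite /key -/m.
  have := leq_mul lt (leqnn m); rewrite mulSn; lia.
apply: (@instance_order R I n G i (fun x y => key x <= key y)%N) => //.
- split=> [x _|x y _ _|x y z _ _ _|x y _ _] /=.
  + exact: leqnn.
  + by rewrite -eqn_leq => /eqP /key_inj.
  + exact: leq_trans.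
  + exact: leq_total.
- move=> s t st x y; rewrite !inE => /andP[_ /eqP xs] /andP[_ /eqP yt].
  by apply: key_lt; have := g2 x; rewrite xs yt; lia.
- move=> x y xB yAB; apply: key_lt; have := hBA x y xB yAB.
  by move: yAB; rewrite inE /g xB => /andP[/negbTE -> ->] /=; lia.
- move=> x y xA yC; apply: key_lt; have := hAC x y xA yC.
  have yA : y \notin A by apply/negP => yA; move/pred0P/(_ y): dAC; rewrite /= yA yC.
  have yB : y \notin B by apply: contra yA; apply: (fintype.subsetP BA).
  rewrite /g (negbTE yA) (negbTE yB) xA; case: (x \in B) => /=; lia.
Qed.

(* Inserting [e] below the later elements lowers their marginal value. *)
Lemma marginal_earliest i B X e : B \subset N -> X \subset N -> e \in N ->
  (forall x, x \in X -> (e.2 <= x.2)%N) ->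
  marginal (f i) [set e] (X :|: B) <= marginal (f i) [set e] (before B e.2).
Proof.
move=> BN XN eN eX.
have PB : before B e.2 \subset B by apply/fintype.subsetP => x; rewrite inE => /andP[].
have PN := fintype.subset_trans PB BN.
(* If [e] is already present, the left side is 0 and monotonicity suffices. *)
have [eXB|eXB] := boolP (e \in X :|: B).
  rewrite {1}/marginal (finset.setUidPr _) ?finset.sub1set // subrr.
  by apply: marginal_ge0; rewrite ?finset.sub1set.
pose D := (X :|: B) :\: before B e.2.
have XBE : X :|: B = D :|: before B e.2.
  apply/setP => x; rewrite !inE; by case: (x \in X); case: (x \in B); case: (_ < _)%N.
have DN : D \subset N.
  apply: fintype.subset_trans (finset.subsetDl _ _) _.
  by rewrite finset.subUset XN.
have De (x : config I n) : x \in D -> (e.2 <= x.2)%N.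
  rewrite !inE negb_and -leqNgt => /andP[/orP[xB|//]].
  by rewrite (negbTE xB) orbF => /eX.
have := @marginal_diminishing i (e |: before B e.2) (before B e.2) D.
rewrite finset.subUset finset.sub1set eN PN finset.subsetUr DN => /(_ isT isT isT).
rewrite /marginal => H.
(* Both inequalities involve the same four values: that [e] lowers the marginal of [D] is the same
   as that [D] lowers the marginal of [e]. *)
suff : f i (D :|: (e |: before B e.2)) - f i (e |: before B e.2) <=
       f i (D :|: before B e.2) - f i (before B e.2).
  by rewrite XBE finset.setUCA; lra.
apply: H.
- apply/pred0P => x /=; rewrite !inE; apply/negP => /andP[/orP[/eqP->|->]//].
  by move: eXB; rewrite inE => /negbTE ->; rewrite andbF.
- move=> x y; rewrite !inE => /andP[_ xe] /andP[/negbTE ->]; rewrite orbF => /eqP ->.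
  exact: ltnW.
- move=> x y xA /De; move: xA; rewrite !inE => /orP[/eqP-> //|/andP[_ xe]].
  by apply: leq_trans; exact: ltnW.
Qed.

(** Induction on [#|X|], removing an element of earliest arrival so that [marginal_earliest] applies
    to it over the remaining ones. *)
Lemma union_bound i B X : B \subset N -> X \subset N ->
  f i (X :|: B) <= f i B + \sum_(e in X) marginal (f i) [set e] (before B e.2).
Proof.
move=> BN; move: {2}#|X| (erefl #|X|) => k; elim: k X => [|k IH] X kX XN.
  by move/eqP: kX; rewrite cards_eq0 => /eqP ->; rewrite finset.set0U big_set0 addr0.
have [e0 e0X] : exists e, e \in X by apply/set0Pn; rewrite -cards_eq0 kX.
have [e eX emin] := @arg_minnP _ e0 (mem X) (fun e => e.2 : nat) e0X.
have {}eX : e \in X := eX.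
have X'N : X :\ e \subset N by apply: fintype.subset_trans XN; exact: finset.subsetDl.
have kX' : #|X :\ e| = k by move: kX; rewrite (cardsD1 e X) eX => -[].
have -> : X :|: B = [set e] :|: (X :\ e :|: B) by rewrite finset.setUA finset.setD1K.
rewrite (big_setD1 e) //=.
have := @marginal_earliest i B (X :\ e) e BN X'N (fintype.subsetP XN _ eX).
rewrite {1}/marginal lerBlDr => /(_ _)/le_trans; apply.
  by move=> x; rewrite inE => /andP[_]; exact: emin.
by rewrite addrCA lerD2l IH.
Qed.

(** * Independent activity and the expectation [F] *)

Lemma gammaU1 i e D X : e \in D -> X \subset D :\ e ->
  gamma G i (e |: X) D = p i e * gamma G i X (D :\ e).
Proof.
move=> eD; rewrite finset.subsetD1 => /andP[XD eX].
rewrite /gamma big_setU1 //= mulrA; congr (_ * _ * _).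
by rewrite finset.setDDl.
Qed.

Lemma gammaD1 i e D X : e \in D -> X \subset D :\ e ->
  gamma G i X D = (1 - p i e) * gamma G i X (D :\ e).
Proof.
move=> eD; rewrite finset.subsetD1 => /andP[XD eX].
rewrite /gamma [in LHS](@big_setD1 _ _ _ _ e (D :\: X)) ?inE ?eX //= mulrCA.
congr (_ * (_ * _)).
by apply: eq_bigl => x; rewrite !inE andbCA.
Qed.

Lemma gamma_sum1 i D : \sum_(X : {set config I n} | X \subset D) gamma G i X D = 1.
Proof.
move: {2}#|D| (erefl #|D|) => k; elim: k D => [|k IH] D kD.
  move/eqP: kD; rewrite cards_eq0 => /eqP ->.
  rewrite (big_pred1 finset.set0) => [|X]; last by rewrite finset.subset0.
  by rewrite /gamma finset.setD0 !big_set0 mulr1.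
have [e eD] : exists e, e \in D by apply/set0Pn; rewrite -cards_eq0 kD.
have kD' : #|D :\ e| = k by move: kD; rewrite (cardsD1 e D) eD => -[].
rewrite (sum_subsets_setD1 _ eD) -(IH _ kD'); apply: eq_bigr => X XD.
by rewrite gammaU1 // (gammaD1 i eD) // -mulrDl subrK mul1r.
Qed.

Lemma gamma_ge0 i X D : X \subset D -> D \subset N -> 0 <= gamma G i X D.
Proof.
move=> XD DN; apply: mulr_ge0; apply: prodr_ge0 => e.
  move/(fintype.subsetP XD)/(fintype.subsetP DN) => eN.
  by have /andP[] := instance_prob i eN.
rewrite inE => /andP[_ /(fintype.subsetP DN) eN].
by rewrite subr_ge0; have /andP[] := instance_prob i eN.
Qed.

Lemma resource_block_sub i : resource_block N i \subset N.
Proof. by apply/fintype.subsetP => e; rewrite inE => /andP[]. Qed.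

Lemma marginal_nonlocal i e S : S \subset N -> e \in N ->
  e \notin resource_block N i -> marginal (f i) [set e] S = 0.
Proof.
move=> SN eN eNi; rewrite /marginal instance_local ?finset.subUset ?finset.sub1set ?eN //.
rewrite [X in _ - X]instance_local //.
suff -> : ([set e] :|: S) :&: resource_block N i = S :&: resource_block N i by rewrite subrr.
rewrite finset.setIUl (_ : [set e] :&: _ = finset.set0) ?finset.set0U //.
by apply/eqP; rewrite setI_eq0 finset.disjoints1.
Qed.

(* The activity of [e] is independent of that of [S]. *)
Lemma marginal_F i e S : S \subset N -> e \in N -> e \notin S ->
  marginal (F G i) [set e] S = p i e *
  \sum_(Z : {set config I n} | Z \subset resource_block N i)
     gamma G i Z (resource_block N i) * marginal (f i) [set e] (Z :&: S).
Proof.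
move=> SN eN eS; rewrite /marginal /F -sumrB.
have ZSN Z : Z :&: S \subset N by apply: fintype.subset_trans SN; exact: finset.subsetIr.
have [eNi|eNi] := boolP (e \in resource_block N i); last first.
  rewrite !big1 ?mulr0 // => Z ZNi.
    by rewrite -/(marginal (f i) [set e] _) marginal_nonlocal // mulr0.
  have eZ : e \notin Z by apply: contra eNi; apply: fintype.subsetP.
  rewrite finset.setIUr (_ : Z :&: [set e] = finset.set0) ?finset.set0U ?subrr //.
  by apply/eqP; rewrite setI_eq0 disjoint_sym finset.disjoints1.
(* The outcomes [X] and [e |: X] are paired. Only the second one gains [e] on the left; on the right
   both give the same marginal since [e \notin S], so their weights [1 - p i e] and [p i e] add up
   to 1. *)
rewrite !(sum_subsets_setD1 _ eNi) big_distrr /=; apply: eq_bigr => X XD.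
have eX : e \notin X by move: XD; rewrite finset.subsetD1 => /andP[].
have -> : X :&: (e |: S) = X :&: S.
  rewrite finset.setIUr (_ : X :&: [set e] = finset.set0) ?finset.set0U //.
  by apply/eqP; rewrite setI_eq0 disjoint_sym finset.disjoints1.
have -> : (e |: X) :&: (e |: S) = e |: (X :&: S) by rewrite finset.setUIr.
have -> : (e |: X) :&: S = X :&: S.
  rewrite finset.setIUl (_ : [set e] :&: S = finset.set0) ?finset.set0U //.
  by apply/eqP; rewrite setI_eq0 finset.disjoints1.
rewrite gammaU1 // (gammaD1 i eNi) //.
set a := gamma _ _ _ _; set u := f i _; set v := f i (X :&: S).
by rewrite subrr add0r -!mulrBr -mulrDl -mulrDl subrK mul1r mulrA.
Qed.

Lemma marginal_F_ge0 i e S : S \subset N -> e \in N -> 0 <= marginal (F G i) [set e] S.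
Proof.
move=> SN eN; rewrite subr_ge0; apply: ler_sum => Z ZNi.
have ZN := fintype.subset_trans ZNi (resource_block_sub i).
rewrite ler_wpM2l ?gamma_ge0 ?resource_block_sub // instance_mono //.
  by apply: finset.setIS; exact: finset.subsetUr.
by apply: fintype.subset_trans ZN; exact: finset.subsetIl.
Qed.

(** * Bounding [Fc_value] by means of any set of choices *)

Lemma Fc_value_le i A y alpha : A \subset N -> Fc_feasible G i y alpha ->
  Fc_value G i alpha <= F G i A +
    \sum_(e in N) y e * marginal (F G i) [set e] (before A e.2).
Proof.
move=> AN [a0 a1 ap].
pose Ni := resource_block N i.
(* The expected marginal of an active [e] over the active earlier choices: [p i e * m e] is the
   marginal of [F]. *)
pose m e := \sum_(Z : {set config I n} | Z \subset Ni)
     gamma G i Z Ni * marginal (f i) [set e] (Z :&: before A e.2).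
have bN e : before A e.2 \subset N.
  by apply: fintype.subset_trans AN; apply/fintype.subsetP => x; rewrite inE => /andP[].
have ZAN Z S : S \subset N -> Z :&: S \subset N.
  by apply: fintype.subset_trans; exact: finset.subsetIr.
have g0 Z : Z \subset Ni -> 0 <= gamma G i Z Ni.
  by move=> ZNi; rewrite gamma_ge0 ?resource_block_sub.
have m0 e : e \in N -> 0 <= m e.
  move=> eN; apply: sumr_ge0 => Z ZNi.
  by rewrite mulr_ge0 ?g0 // marginal_ge0 ?ZAN // finset.sub1set.
(* For fixed [X], [union_bound] is averaged over the activity [Z], whose weights sum to 1. *)
have fX X : X \subset N -> f i X <= F G i A + \sum_(e in X) m e.
  move=> XN; rewrite -[f i X]mul1r -(gamma_sum1 i Ni) big_distrl /=.
  rewrite /m exchange_big /= /F -/Ni -big_split /=; apply: ler_sum => Z ZNi.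
  rewrite -big_distrr -mulrDr /= ler_wpM2l ?g0 //.
  apply: (@le_trans _ _ (f i (X :|: (Z :&: A)))).
    by rewrite instance_mono ?finset.subsetUl // finset.subUset XN ZAN.
  have := @union_bound i (Z :&: A) X (ZAN _ _ AN) XN.
  suff -> : \sum_(e in X) marginal (f i) [set e] (before (Z :&: A) e.2) =
    \sum_(e in X) marginal (f i) [set e] (Z :&: before A e.2) by [].
  apply: eq_bigr => e _; congr marginal.
  by apply/setP => x; rewrite !inE andbA.
apply: (@le_trans _ _ (\sum_(X : {set config I n} | X \subset N)
    alpha X * (F G i A + \sum_(e in X) m e))).
  by apply: ler_sum => X XN; rewrite ler_wpM2l ?a0 ?fX.
under eq_bigr do rewrite mulrDr.
rewrite big_split /= -big_distrl /= a1 mul1r lerD2l.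
(* Exchanging the sums weights [m e] by the probability that [alpha] selects [e], which [ap]
   bounds. *)
have -> : \sum_(X : {set config I n} | X \subset N) alpha X * (\sum_(e in X) m e) =
  \sum_(e in N) (\sum_(X : {set config I n} | (X \subset N) && (e \in X)) alpha X) * m e.
  under eq_bigr do rewrite big_distrr /=.
  under [RHS]eq_bigr do rewrite big_distrl /=.
  apply: exchange_big_dep => X e XN eX; exact: fintype.subsetP eX.
(* [before A e.2] holds strictly earlier arrivals only, so it omits [e], as [marginal_F]
   requires. *)
apply: ler_sum => e eN; rewrite marginal_F // ?inE ?ltnn ?andbF //.
by rewrite mulrA [y e * _]mulrC ler_wpM2r ?m0 ?ap.
Qed.

(** * Gains along a run of greedy *)

Section Run.
Variable alg : 'I_n -> option (config I n).
Hypothesis algG : nonadaptive_greedy G alg.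

Lemma greedy_arrival t e : alg t = Some e -> e \in N /\ e.2 = t.
Proof. by have := algG t; case: (alg t) => // x [+ _] [<-]; rewrite inE => /andP[-> /eqP]. Qed.

Lemma chosen_before_sub k : chosen_before alg k \subset N.
Proof.
by apply/fintype.subsetP => e; rewrite inE => /existsP[s /andP[_ /eqP /greedy_arrival[]]].
Qed.

Lemma before_chosen (t : 'I_n) : before (chosen alg) t = chosen_before alg t.
Proof.
apply/setP => e; rewrite !inE; apply/andP/existsP.
  move=> [/existsP[s /andP[_ /eqP es]] et]; exists s.
  by have [_ se] := greedy_arrival es; rewrite es eqxx andbT -se.
move=> [s /andP[st /eqP es]]; have [_ ->] := greedy_arrival es.
by split=> //; apply/existsP; exists s; rewrite ltn_ord es eqxx.
Qed.

Lemma chosen_beforeS (t : 'I_n) :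
  chosen_before alg t.+1 = (if alg t is Some e then [set e] else finset.set0)
    :|: chosen_before alg t.
Proof.
apply/setP => e; rewrite !inE; apply/existsP/orP.
  move=> [s /andP[]]; rewrite ltnS leq_eqVlt => /orP[/eqP/ord_inj->|st] es.
    by left; rewrite (eqP es) inE.
  by right; apply/existsP; exists s; rewrite st.
case; last by move=> /existsP[s /andP[st es]]; exists s; rewrite ltnS ltnW.
by case E: (alg t) => [x|]; rewrite inE // => /eqP ->; exists t; rewrite ltnS leqnn E eqxx.
Qed.

(** Each score is at most that of the greedy choice, whose score is exactly the increase on the
    right. *)
Lemma greedy_step y (t : 'I_n) : Delta G y ->
  \sum_(e in arrival_block N t) y e * greedy_score G (chosen_before alg t) e <=
  \sum_i F G i (chosen_before alg t.+1) - \sum_i F G i (chosen_before alg t).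
Proof.
move=> [y0 y1]; rewrite chosen_beforeS; have := algG t.
case: (alg t) => [e [eN emax]|->]; last by rewrite big_set0 finset.set0U subrr.
rewrite -sumrB -/(greedy_score G (chosen_before alg t) e).
have NtN x : x \in arrival_block N t -> x \in N by rewrite inE => /andP[].
apply: (@le_trans _ _ (\sum_(x in arrival_block N t) y x *
    greedy_score G (chosen_before alg t) e)).
  by apply: ler_sum => x xN; rewrite ler_wpM2l ?y0 ?emax ?NtN.
(* The total weight may be below 1, so the greedy score must be nonnegative. *)
rewrite -big_distrl /= ler_piMl // sumr_ge0 // => i _.
by rewrite marginal_F_ge0 ?chosen_before_sub ?NtN.
Qed.

(** Grouped by arrival, the bounds of [greedy_step] telescope. *)
Lemma greedy_fractional y : Delta G y ->
  \sum_(e in N) y e * greedy_score G (before (chosen alg) e.2) e <=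
  \sum_i F G i (chosen alg).
Proof.
move=> Dy; rewrite (partition_big (fun e => e.2) predT) //=.
apply: (@le_trans _ _ (\sum_(t < n)
   (\sum_i F G i (chosen_before alg t.+1) - \sum_i F G i (chosen_before alg t)))).
  apply: ler_sum => t _; apply: le_trans (greedy_step t Dy).
  rewrite le_eqVlt; apply/orP; left; apply/eqP; apply: eq_big => e.
    by rewrite inE.
  by move=> /andP[_ /eqP ->]; rewrite before_chosen.
rewrite -(big_mkord predT (fun k => \sum_i F G i (chosen_before alg k.+1) -
  \sum_i F G i (chosen_before alg k))) telescope_sumr // lerBlDr lerDl.
(* What remains is that the initial term of the telescoping sum is nonnegative. *)
apply: sumr_ge0 => i _; apply: sumr_ge0 => Z ZNi.
have ZN := fintype.subset_trans ZNi (resource_block_sub i).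
rewrite mulr_ge0 ?gamma_ge0 ?resource_block_sub // instance_nonneg //.
by apply: fintype.subset_trans ZN; exact: finset.subsetIl.
Qed.

(** The value of greedy is counted twice: as [F G i A] in [Fc_value_le], and as the bound on the
    fractional gains. *)
Lemma Fc_sum_le y : Delta G y ->
  \sum_i Fc G i y <= 2 * \sum_i F G i (chosen alg).
Proof.
move=> Dy; rewrite mulr2n mulrDl mul1r.
apply: le_trans (lerD (lexx _) (greedy_fractional Dy)).
under [X in _ + X]eq_bigr do rewrite big_distrr /=.
rewrite exchange_big -big_split /=; apply: ler_sum => i _.
have [[alpha fa <-] _] := Fc_max i Dy.
exact: Fc_value_le (chosen_before_sub _) fa.
Qed.

End Run.
End Greedy.

Theorem theorem2 (R : realType) (I : finType) (n : nat) (G : instance R I n)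
  (alg : 'I_n -> option (config I n)) :
  nonadaptive_greedy G alg ->
  1 / 2 * OPTc G <= \sum_(i : I) F G i (chosen alg).
Proof.
move=> algG; have [[y Dy <-] _] := OPTc_max G.
by rewrite mul1r mulrC ler_pdivrMr ?ltr0n // mulrC Fc_sum_le.
Qed.
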